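(* For all $K\ge 1$, $0<\alpha<1$ and $\lambda\in\mathbb{N}$ there exists $N=N(K,\alpha,\lambda)\in\mathbb{N}$, depending only on $K,\alpha,\lambda$, such that the following holds. Let $X$ be a complete geodesic metric space and let $x\in X$ be a point satisfying the $\mathrm{LEG}$ condition with parameter $\epsilon>0$ and the $\mathrm{LRB}$ condition with parameters $H>0$ and $K$. Let $R=\frac12\min\{\epsilon,H\}$ and suppose that $B_R(x)$ has the doubling property with constant $\lambda$. Then $B_{\frac{R(1-\alpha)}{6K}}(x)$ is free of $N$-point $\mathrm{SRA}(\alpha)$ subspaces.
   Context: A metric space is geodesic if every two points $x,y$ are joined by a continuous curve of length $d(x,y)$. $B_r(x)$ denotes the open ball, regarded as a metric space with the induced metric. $\mathrm{LEG}$ (locally extendable geodesics) condition: a point $x$ of a complete geodesic metric space $X$ satisfies $\mathrm{LEG}$ with parameter $\epsilon>0$ if for every unit speed minimizing geodesic $\gamma:[0,T]\to B_\epsilon(x)$ there exists a unit speed minimizing geodesic $\widetilde\gamma:[0,T+\epsilon]\to X$ with $\widetilde\gamma(t)=\gamma(t)$ for all $t\in[0,T]$. $\mathrm{LRB}$ (locally rough Busemann) condition: a point $x$ of a complete geodesic metric space $X$ satisfies $\mathrm{LRB}$ with parameters $H,K>0$ if for every pair of unit speed minimizing geodesics $\gamma_1:[0,L_1]\to B_H(x)$, $\gamma_2:[0,L_2]\to B_H(x)$ with $\gamma_1(0)=\gamma_2(0)$ we have $d(\gamma_1(tL_1),\gamma_2(tL_2))\le K\,t\,d(\gamma_1(L_1),\gamma_2(L_2))$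 for every $t\in[0,1]$. A metric space has the doubling property with constant $\lambda\in\mathbb{N}$ if, for every $\rho>0$, every ball of radius $\rho$ in it can be covered by at most $\lambda$ balls of radius $\rho/2$. For $0<\alpha<1$, a metric space $(Y,d)$ satisfies the $\mathrm{SRA}(\alpha)$ condition if for all $x,y,z\in Y$, $d(x,y)\le\max\{d(x,z)+\alpha d(z,y),\ \alpha d(x,z)+d(z,y)\}$. A metric space is free of $N$-point $\mathrm{SRA}(\alpha)$ subspaces if no $N$-point subset of it (with the induced metric) satisfies the $\mathrm{SRA}(\alpha)$ condition. *)

(* Defs.v *)
From HB Require Import structures.
From mathcomp Require Import all_boot all_order all_algebra.
From mathcomp Require Import all_classical all_reals all_analysis.
Set Implicit Arguments.
Unset Strict Implicit.
Unset Printing Implicit Defensive.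
Import Order.TTheory GRing.Theory Num.Theory.
Import numFieldNormedType.Exports.
Local Open Scope classical_set_scope.
Local Open Scope ring_scope.

#[short(type="completeMetricType")]
HB.structure Definition CompleteMetric (R : numDomainType) :=
  {T of Metric R T & Complete T}.

(* A curve [a, b] -> X is a total function R -> X of which only the
   restriction to [a, b] matters. *)

Definition curve_length (R : realType) (X : metricType R) (a b : R)
    (c : R -> X) : \bar R :=
  ereal_sup [set (\sum_(0 <= i < size s)
                   mdist (c (nth b (a :: s) i)) (c (nth b (a :: s) i.+1)))%:E
            | s in itv_partition a b].

Definition geodesic_space (R : realType) (X : metricType R) : Prop :=
  forall x y : X, exists (a b : R) (c : R -> X),
    [/\ a <= b, {within `[a, b], continuous c}, c a = x, c b = y
      & curve_length a b c = (mdist x y)%:E].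

(* The parameter interval [0, T] is nondegenerate. *)
Definition unit_speed_geodesic (R : realType) (X : metricType R) (T : R)
    (g : R -> X) : Prop :=
  0 < T /\
  forall s t : R, s \in `[0, T] -> t \in `[0, T] ->
    mdist (g s) (g t) = `|s - t|.

Definition LEG (R : realType) (X : metricType R) (eps : R) (x : X) : Prop :=
  forall (T : R) (g : R -> X),
    unit_speed_geodesic T g ->
    (forall t : R, t \in `[0, T] -> ball x eps (g t)) ->
    exists h : R -> X,
      unit_speed_geodesic (T + eps) h /\
      forall t : R, t \in `[0, T] -> h t = g t.

Definition LRB (R : realType) (X : metricType R) (H K : R) (x : X) : Prop :=
  forall (L1 L2 : R) (g1 g2 : R -> X),
    unit_speed_geodesic L1 g1 ->
    (forall t : R, t \in `[0, L1] -> ball x H (g1 t)) ->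
    unit_speed_geodesic L2 g2 ->
    (forall t : R, t \in `[0, L2] -> ball x H (g2 t)) ->
    g1 0 = g2 0 ->
    forall t : R, t \in `[0, 1] ->
      mdist (g1 (t * L1)) (g2 (t * L2)) <= K * t * mdist (g1 L1) (g2 L2).

(* Doubling property of the subspace A with its induced metric: balls of A are
   the sets A `&` ball y r with y in A, so the covering balls must also be
   centered in A. *)
Definition doubling (R : realType) (X : metricType R) (A : set X)
    (lambda : nat) : Prop :=
  forall (rho : R) (y : X), 0 < rho -> A y ->
    exists s : seq X,
      [/\ (size s <= lambda)%N,
          forall z, z \in s -> A z
        & A `&` ball y rho `<=`
            [set w | exists2 z, z \in s & (A `&` ball z (rho / 2)) w]].

Definition SRA (R : realType) (X : metricType R) (alpha : R) (Y : set X)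
    : Prop :=
  forall x y z : X, Y x -> Y y -> Y z ->
    mdist x y <= Num.max (mdist x z + alpha * mdist z y)
                         (alpha * mdist x z + mdist z y).

Definition SRA_free (R : realType) (X : metricType R) (alpha : R) (N : nat)
    (A : set X) : Prop :=
  forall Y : set X, Y `<=` A -> (Y #= `I_N)%card -> ~ SRA alpha Y.

(* Main.v *)
Require Import Defs.
From HB Require Import structures.
From mathcomp Require Import all_boot all_order all_algebra.
From mathcomp Require Import all_classical all_reals all_analysis.
From mathcomp Require Import lra ring.
Import Order.TTheory GRing.Theory Num.Theory.
Import numFieldNormedType.Exports.
Local Open Scope classical_set_scope.
Local Open Scope ring_scope.

(* Fix a scale L = r/2.  From a point z of the small ball, LEG extends every
   geodesic to a point y of the small ball up to length L; colour the pair
   (z, y) by the member of a net of B_r(x) close to the endpoint of this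
   extension.  Iterated doubling bounds the number of colours in terms of K,
   alpha and lambda.  If y and w have the same colour from z, with
   d(z,y) <= d(z,w), then LRB makes y almost lie between z and w, and SRA(alpha)
   forbids this unless d(y,w) <= d(z,y)/2.  In any colouring of the ordered
   pairs of a large set there are distinct z, y, q such that y, q have the same
   colour from z and y, z have the same colour from q.  For an SRA(alpha) set
   this gives d(y,q) <= d(z,y)/2 and d(y,z) <= d(q,y)/2, which is absurd. *)

(** * From shortest curves to unit speed geodesics *)

Lemma continuous_mdist {R : realType} {X : metricType R} (x : X) :
  continuous (fun y : X => mdist x y : R).
Proof.
move=> y; apply/cvgrPdist_le => e e0.
have : nbhs y [set z | mdist y z < e] by rewrite -ballEmdist; exact: nbhsx_ballx.
apply: filterS => z /= yze.
have := metric_triangle x y z; have := metric_triangle x z y.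
by rewrite (metric_sym z y) ler_norml => *; apply/andP; split; lra.
Qed.

Lemma curve_length_ge3 {R : realType} {X : metricType R} (a b s t : R)
    (c : R -> X) : a <= s -> s <= t -> t <= b ->
  ((mdist (c a) (c s) + mdist (c s) (c t) + mdist (c t) (c b))%:E
    <= curve_length a b c)%E.
Proof.
have sumE l : itv_partition a b l ->
    ((\sum_(0 <= i < size l) mdist (c (nth b (a :: l) i))
                                   (c (nth b (a :: l) i.+1)))%:E
      <= curve_length a b c)%E.
  by move=> abl; apply: ereal_sup_ubound; exists l.
(* The points of an [itv_partition] strictly increase, so coinciding points among a, s, t, b must be
   dropped; their terms vanish. *)
rewrite le_eqVlt => /predU1P[<-|la]; rewrite le_eqVlt => /predU1P[<-|lb];
  rewrite le_eqVlt => /predU1P[tb|lc]; rewrite -?tb ?mdistxx; rewrite -?tb in sumE.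
- by have := sumE [::]; rewrite big_nil !addr0; apply; split.
- by have := sumE [:: b]; rewrite unlock /= !addr0 !add0r; apply; split;
    rewrite /= ?lc.
- have := sumE [:: t]; rewrite unlock /= !addr0 !add0r; apply; split;
    by rewrite /= ?lb.
- have := sumE [:: t; b]; rewrite unlock /= !addr0 !add0r; apply; split;
    by rewrite /= ?lb ?lc.
- have := sumE [:: s]; rewrite unlock /= !addr0; apply; split;
    by rewrite /= ?la.
- have := sumE [:: s; b]; rewrite unlock /= !addr0; apply; split;
    by rewrite /= ?la ?lc.
- have := sumE [:: s; t]; rewrite unlock /= !addr0; apply; split;
    by rewrite /= ?la ?lb.
- have := sumE [:: s; t; b]; rewrite unlock /= !addr0 addrA; apply; split;
    by rewrite /= ?la ?lb ?lc.
Qed.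

(* Equality in the triangle inequality along [c] makes t |-> d(x, c t) an arc
   length function, so any right inverse of it (by IVT) reparametrizes [c] by
   unit speed. *)
Lemma geodesic_space_unit_speed {R : realType} {X : metricType R} (x y : X) :
  geodesic_space X -> x != y ->
  exists g : R -> X,
    [/\ unit_speed_geodesic (mdist x y) g, g 0 = x & g (mdist x y) = y].
Proof.
move=> geoX xy; have [a [b [c [ab cc ca cb lenc]]]] := geoX x y.
pose f u := mdist x (c u).
have fa : f a = 0 by rewrite /f ca mdistxx.
have fb : f b = mdist x y by rewrite /f cb.
have dist_f s t : a <= s -> s <= t -> t <= b ->
    mdist (c s) (c t) = f t - f s.
  move=> las lst ltb; have := curve_length_ge3 _ _ _ _ c las lst ltb.
  rewrite lenc lee_fin ca cb => leD; apply/eqP; rewrite eq_le /f.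
  have := metric_triangle x (c t) y; have := metric_triangle x (c s) (c t).
  by move=> *; apply/andP; split; lra.
have cf : {within `[a, b], continuous f}.
  by move=> u; apply: continuous_comp; [exact: cc|exact: continuous_mdist].
have /choice[s sP] u : exists v, u \in `[0, mdist x y] ->
    v \in `[a, b] /\ f v = u.
  have [uI|] := boolP (u \in `[0, mdist x y]); last by exists 0.
  have [|v vab fv] := IVT (v := u) ab cf; last by exists v.
  by rewrite fa fb min_l ?max_r ?mdist_ge0//; move: uI; rewrite in_itv.
have I0 : 0 \in `[0, mdist x y] by rewrite in_itv/= lexx mdist_ge0.
have I1 : mdist x y \in `[0, mdist x y] by rewrite in_itv/= lexx mdist_ge0.
exists (c \o s); split => /=.
- split; first by rewrite mdist_gt0.
  move=> u v /sP[/[!in_itv]/= /andP[su1 su2] fsu].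
  move=> /sP[/[!in_itv]/= /andP[sv1 sv2] fsv] /=.
  rewrite -{2}fsu -{2}fsv; have [uv|/ltW vu] := leP (s u) (s v).
    rewrite distrC (dist_f _ _ su1 uv sv2) ger0_norm//.
    by rewrite -dist_f// mdist_ge0.
  rewrite metric_sym (dist_f _ _ sv1 vu su2) ger0_norm//.
  by rewrite -dist_f// mdist_ge0.
- by have [_ /mdist_positivity] := sP _ I0.
(* [s] need not send [mdist x y] to b, but [f] already takes its value at b there, so [c] is at
   distance 0 from y. *)
- have [/[!in_itv]/= /andP[s1 s2] fs] := sP _ I1.
  apply: mdist_positivity; have := dist_f _ _ s1 s2 (lexx b).
  by rewrite fs fb subrr cb.
Qed.

(** * Nets from iterated doubling *)

Lemma doubling_cover {R : realType} {X : metricType R} (x : X) (r : R)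
    (lambda k : nat) : 0 < r -> doubling (ball x r) lambda ->
  exists s : seq X,
    [/\ (size s <= lambda ^ k)%N, forall z, z \in s -> ball x r z
      & ball x r `<=` [set w | exists2 z, z \in s & ball z (r / 2 ^+ k) w]].
Proof.
move=> r0 dbl; elim: k => [|k [s [size_s sA scov]]].
  exists [:: x]; split => //.
    by move=> z /[!inE] /eqP ->; exact: ballxx.
  by move=> w xw; exists x; rewrite ?inE// expr0 divr1.
(* The new centres stay in [ball x r], which lets doubling be applied again at half the radius. *)
have /choice[t tP] z : exists t : seq X, ball x r z ->
    [/\ (size t <= lambda)%N, forall w, w \in t -> ball x r w
      & ball x r `&` ball z (r / 2 ^+ k) `<=`
        [set w | exists2 z, z \in t & ball z (r / 2 ^+ k.+1) w]].
  have [Az|nAz] := pselect (ball x r z); last by exists [::].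
  have [|t [size_t tA tcov]] := dbl (r / 2 ^+ k) z _ Az.
    by rewrite divr_gt0// exprn_gt0.
  exists t => _; split=> // w /tcov[v vt [_]].
  by rewrite -mulrA -invfM -exprSr; exists v.
exists (flatten [seq t z | z <- s]); split.
- rewrite size_flatten /shape -map_comp sumnE big_map.
  apply: (@leq_trans (\sum_(z <- s) lambda)%N).
    rewrite big_seq [leqRHS]big_seq; apply: leq_sum => z /sA /tP[] //.
  by rewrite big_const_seq count_predT iter_addn_0 mulnC expnSr leq_mul2r size_s orbT.
- by move=> w /flatten_mapP[z /sA /tP[_ + _]]; apply.
- move=> w Aw; have [z zs zw] := scov w Aw.
  have [_ _ /(_ w (conj Aw zw))[v vt vw]] := tP z (sA z zs).
  by exists v => //; apply/flatten_mapP; exists z.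
Qed.

(** * Colourings of ordered pairs *)

(** Vertices needed for m more greedy choices: one is chosen, and among [M * n + 1] others some
    colour occurs more than n times. The base value leaves one vertex to look back at all the chosen
    ones. *)
Fixpoint two_vertex_bound (M m : nat) : nat :=
  if m is m'.+1 then (M * two_vertex_bound M m').+2 else 1%N.

Lemma pigeonhole_color {T : finType} {M : nat} (h : T -> 'I_M) (A : {set T})
    (n : nat) : (M * n < #|A|)%N ->
  exists c, (n < #|[set y in A | h y == c]|)%N.
Proof.
move=> ltA; apply/existsP; apply: contraLR ltA => /existsPn small.
rewrite -leqNgt -sum1_card (partition_big h xpredT)//=.
apply: (@leq_trans (\sum_(c < M) n)%N); last by rewrite sum_nat_const card_ord.
apply: leq_sum => c _; rewrite sum1dep_card.
by have := small c; rewrite -leqNgt.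
Qed.

Lemma two_vertex_monochromatic (M : nat) (T : finType) (f : T -> T -> 'I_M) :
  (two_vertex_bound M M.+1 <= #|T|)%N ->
  exists z y q, [/\ z != y, z != q, y != q, f z y = f z q & f q y = f q z].
Proof.
move=> leT; apply: contrapT => no.
have {}no z y q : z != y -> z != q -> y != q -> f z y = f z q ->
    f q y != f q z.
  move=> zy zq yq fz; apply/eqP => fq; apply: no; exists z, y, q; split=> //.
(* [t] is the list of vertices chosen so far, each of which sees all of the
   remaining set [A] in a single colour; then every q in [A] must see the
   vertices of [t] in distinct colours, which bounds the size of [t] by M. *)
suff step m (t : seq T) (A : {set T}) : (size t + m = M.+1)%N ->
    (two_vertex_bound M m <= #|A|)%N -> (forall z, z \in t -> z \notin A) ->
    (forall z y q, z \in t -> y \in A -> q \in A -> f z y = f z q) ->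
    (forall q, q \in A -> uniq (map (f q) t)) -> False.
  by apply: (step M.+1 [::] [set: T]%SET); rewrite ?cardsT.
elim: m t A => [|m IH] t A sizet leA tA tconst uniqA.
  have /card_gt0P[q /uniqA uq] := leA.
  have := card_uniqP uq; rewrite size_map => /esym sz.
  have := max_card (mem (map (f q) t)).
  by rewrite -sz card_ord -[size t]addn0 sizet ltnn.
have /card_gt0P[z zA] : (0 < #|A|)%N by apply: leq_trans leA.
have [|c ltc] := @pigeonhole_color T M (f z) (A :\ z) (two_vertex_bound M m).
  by move: leA; rewrite (cardsD1 z A) zA add1n.
apply: (IH (z :: t) [set y in A :\ z | f z y == c]).
- by rewrite /= addSn -addnS.
- exact: ltnW.
- move=> u /[!inE] /predU1P[->|/tA/negPf ->]; first by rewrite eqxx.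
  by rewrite andbF.
- move=> u y q /[!inE] ut /andP[/andP[yz yA] /eqP fy] /andP[/andP[qz qA] /eqP fq].
  by move: ut => /predU1P[->|ut]; [rewrite fy fq|exact: tconst].
- move=> q /[!inE] /andP[/andP[qz qA] _] /=; rewrite uniqA// andbT.
  (* A vertex u of [t] sees z and q in one colour, so q seeing u and z in one colour would complete
     an excluded triple. *)
  apply/mapP => -[u ut fqz].
  have nu v : v \in A -> u != v by apply: contraTneq => <-; exact: tA.
  have := no u z q (nu z zA) (nu q qA); rewrite eq_sym => /(_ qz).
  by move=> /(_ (tconst u z q ut zA qA)); rewrite fqz eqxx.
Qed.

(** * Extended geodesics and their directions *)

Lemma extended_geodesic {R : realType} {X : metricType R} (x z y : X)
    (eps rho L : R) :
  geodesic_space X -> LEG eps x -> 2 * rho <= eps -> 0 < L <= eps ->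
  ball x rho z -> ball x rho y -> z != y ->
  exists g : R -> X,
    [/\ unit_speed_geodesic L g, g 0 = z, g (mdist z y) = y
      & forall t, t \in `[0, L] -> ball x (L + rho) (g t)].
Proof.
rewrite !ballEmdist /= => geoX legx rho_eps /andP[L0 Leps] xz xy zy.
have [g [[T0 gdist] g0 gT]] := geodesic_space_unit_speed _ _ geoX zy.
have zy_lt : mdist z y < 2 * rho.
  by have := metric_triangle z x y; rewrite (metric_sym z x); lra.
have I0 : 0 \in `[0, mdist z y] by rewrite in_itv/= lexx ltW.
have I1 : mdist z y \in `[0, mdist z y] by rewrite in_itv/= lexx ltW.
have [|h [[_ hdist] hg]] := legx _ _ (conj T0 gdist).
  (* Averaging the bounds through z and through y gives d(x, g t) <= (d(x,z) + d(x,y) + d(z,y)) / 2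
     < 2 rho <= eps, as LEG requires. *)
  move=> t tI; rewrite ballEmdist /=.
  have := metric_triangle x z (g t); have := metric_triangle x y (g t).
  rewrite -{2}g0 -{2}gT !gdist//; move: tI; rewrite in_itv/= => /andP[t0 tT].
  by rewrite sub0r normrN (ger0_norm t0) ger0_norm ?subr_ge0//; lra.
have subI t : t \in `[0, L] -> t \in `[0, mdist z y + eps].
  by rewrite !in_itv/= => /andP[-> tL] /=; lra.
have h0 : h 0 = z by rewrite hg.
exists h; split=> //.
- by split=> // s t /subI sI /subI tI; exact: hdist.
- by rewrite hg.
- move=> t tI; have := metric_triangle x z (h t).
  rewrite -{2}h0 hdist ?subI//; last by rewrite in_itv/= lexx ltW.
  by move: tI; rewrite in_itv/= sub0r normrN => /andP[t0 tL]; rewrite ger0_norm//; lra.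
Qed.

Lemma direction_coloring {R : realType} {X : metricType R} (x : X)
    (eps H K r rho eta : R) (lambda k : nat) :
  0 < r -> r <= eps -> r <= H -> rho <= r / 6 ->
  0 <= K -> 4 * K <= eta * 2 ^+ k ->
  geodesic_space X -> LEG eps x -> LRB H K x -> doubling (ball x r) lambda ->
  exists f : X -> X -> 'I_(lambda ^ k).+1, forall z y w,
    ball x rho z -> ball x rho y -> ball x rho w -> z != y -> z != w ->
    mdist z y <= mdist z w -> f z y = f z w ->
    mdist y w <= mdist z w - mdist z y + eta * mdist z y.
Proof.
move=> r0 r_eps r_H rho_r K0 K_eta geoX legx lrbx dbl.
have [s [size_s _ scov]] := doubling_cover _ _ _ k r0 dbl.
(* Long enough to pass every point of the small ball, since 2 rho <= r/3 < L, and short enough to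
   stay in [ball x r], since L + rho <= 2r/3. *)
pose L := r / 2.
(* A colour is an index into [s]; the successor keeps the type inhabited, so that irrelevant pairs
   can get [ord0]. *)
have /choice[f fP] (zy : X * X) : exists c : 'I_(lambda ^ k).+1,
    ball x rho zy.1 -> ball x rho zy.2 -> zy.1 != zy.2 ->
    exists g, [/\ unit_speed_geodesic L g, g 0 = zy.1,
      g (mdist zy.1 zy.2) = zy.2,
      forall t, t \in `[0, L] -> ball x H (g t)
      & ball (nth x s c) (r / 2 ^+ k) (g L)].
  case: zy => z y /=.
  have [[xz xy zy]|no] := pselect [/\ ball x rho z, ball x rho y & z != y];
    last by exists ord0 => *; case: no.
  have [||g [gL g0 gy gball]] :=
    @extended_geodesic R X x z y eps rho L geoX legx _ _ xz xy zy.
  - by lra.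
  - by rewrite /L; apply/andP; split; lra.
  have [|p ps pg] := scov (g L).
    by apply: (le_ball (e1 := L + rho)); [rewrite /L; lra|apply: gball];
      rewrite in_itv/= lexx /L; lra.
  exists (inord (index p s)) => _ _ _; exists g; split=> //.
    by move=> t /gball; apply: le_ball; rewrite /L; lra.
  by rewrite inordK ?nth_index// ltnS (leq_trans _ size_s)// ltnW// index_mem.
exists (fun z y => f (z, y)) => z y w xz xy xw zy zw zyw fzyw.
have [g [gL g0 gy gball gend]] := fP (z, y) xz xy zy.
have [h [hL h0 hw hball hend]] := fP (z, w) xz xw zw.
move: gy hw => /= gy hw.
have zwL : mdist z w <= L.
  move: xz xw; rewrite !ballEmdist /= => xz xw.
  by have := metric_triangle z x w; rewrite (metric_sym z x) /L; lra.
have L0 : 0 < L by rewrite /L; lra.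
have ratio u : 0 <= u -> u <= L -> u / L \in `[0, 1].
  move=> u0 uL; rewrite in_itv/= divr_ge0 ?(ltW L0)//=.
  by rewrite ler_pdivrMr// mul1r.
(* At the ratio d(z,y)/L, [g] is at y and [h] is at distance d(z,y) from z on its way to w. The ends
   are within 2r/2^k of each other, so LRB bounds the gap by (4K/2^k) d(z,y) <= eta d(z,y). *)
have := lrbx _ _ _ _ gL gball hL hball (etrans g0 (esym h0)) _
  (ratio _ (mdist_ge0 z y) (le_trans zyw zwL)).
rewrite divfK ?gt_eqF// gy => yh.
have hdist : mdist (h (mdist z y)) w = mdist z w - mdist z y.
  rewrite -{1}hw hL.2; last 2 first.
  - by rewrite in_itv/= mdist_ge0 (le_trans zyw).
  - by rewrite in_itv/= mdist_ge0.
  by rewrite distrC ger0_norm// subr_ge0.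
have ends : mdist (g L) (h L) <= 2 * (r / 2 ^+ k).
  move: gend hend; rewrite -fzyw !ballEmdist /= => gend hend.
  have := metric_triangle (g L) (nth x s (f (z, y))) (h L).
  by rewrite (metric_sym (g L) (nth _ _ _)); lra.
have -> : mdist z w - mdist z y + eta * mdist z y =
    eta * mdist z y + mdist (h (mdist z y)) w by rewrite hdist addrC.
apply: le_trans (metric_triangle _ (h (mdist z y)) _) _.
rewrite lerD2r; apply: le_trans yh _.
have zyL : 0 <= mdist z y / L by rewrite divr_ge0 ?mdist_ge0// ltW.
apply: (le_trans (ler_wpM2l (mulr_ge0 K0 zyL) ends)).
have -> : K * (mdist z y / L) * (2 * (r / 2 ^+ k)) =
    4 * K / 2 ^+ k * mdist z y.
  by rewrite /L; field; rewrite ?gt_eqF// exprn_gt0.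
by rewrite ler_wpM2r ?mdist_ge0// ler_pdivrMr// exprn_gt0.
Qed.

(** Apply SRA to d(z,w) with y as third point. The branch alpha d(z,y) + d(y,w) contradicts the
    assumed bound; the other gives d(z,w) - d(z,y) <= alpha d(y,w), hence (1 - alpha) d(y,w) <= (1 -
    alpha) d(z,y)/2. *)
Lemma SRA_same_direction_close {R : realType} {X : metricType R} (alpha : R)
    (Y : set X) (z y w : X) :
  0 < alpha < 1 -> SRA alpha Y -> Y z -> Y y -> Y w -> z != y ->
  mdist y w <= mdist z w - mdist z y + (1 - alpha) / 2 * mdist z y ->
  mdist y w <= mdist z y / 2.
Proof.
move=> /andP[a0 a1] sraY Yz Yy Yw; rewrite -mdist_gt0 => zy.
have := sraY z w y Yz Yw Yy; rewrite le_max => sra yw.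
have : 0 < (1 - alpha) * mdist z y by rewrite mulr_gt0// subr_gt0.
case/orP: sra => sra gap; last by lra.
have : (1 - alpha) * mdist y w <= (1 - alpha) * (mdist z y / 2) by lra.
by rewrite ler_pM2l// subr_gt0.
Qed.

Theorem theorem3 (R : realType) (K alpha : R) (lambda : nat) :
  1 <= K -> 0 < alpha < 1 ->
  exists N : nat,
    forall (X : completeMetricType R) (x : X) (eps H : R),
      geodesic_space X ->
      0 < eps -> LEG eps x ->
      0 < H -> LRB H K x ->
      let r := 2^-1 * Num.min eps H in
      doubling (ball x r) lambda ->
      SRA_free alpha N (ball x (r * (1 - alpha) / (6 * K))).
Proof.
move=> K1 a01; have /andP[a0 a1] := a01.
(* The error eta is (1 - alpha)/2, as the SRA estimate demands; k is chosen before the space, using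
   n <= 2^n. *)
have [k kP] : exists k : nat, 4 * K <= (1 - alpha) / 2 * 2 ^+ k.
  exists (Num.bound (8 * K / (1 - alpha))).
  set n := Num.bound _; suff: 8 * K / (1 - alpha) <= 2 ^+ n.
    by rewrite ler_pdivrMr ?subr_gt0//; lra.
  apply: (@le_trans _ _ n%:R).
    by apply/ltW/archi_boundP; rewrite divr_ge0//; lra.
  by rewrite -natrX ler_nat ltnW// ltn_expl.
pose M := (lambda ^ k).+1.
exists (two_vertex_bound M M.+1) => X x eps H geoX eps0 legx H0 lrbx r dbl Y subY cardY sraY.
set rho := r * _ / _ in subY.
have min0 : 0 < Num.min eps H by rewrite lt_min eps0.
have r0 : 0 < r by rewrite mulr_gt0// invr_gt0.
have min_eps : Num.min eps H <= eps by rewrite ge_min lexx.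
have min_H : Num.min eps H <= H by rewrite ge_min lexx orbT.
have rho_r : rho <= r / 6.
  rewrite /rho ler_pdivrMr; last by lra.
  have -> : r / 6 * (6 * K) = r * K by field.
  by rewrite ler_pM2l//; lra.
have r_eps : r <= eps by rewrite /r; lra.
have r_H : r <= H by rewrite /r; lra.
have K0 : 0 <= K by lra.
have [f fP] := direction_coloring x eps H K r rho ((1 - alpha) / 2) lambda k
  r0 r_eps r_H rho_r K0 kP geoX legx lrbx dbl.
have close z y w : Y z -> Y y -> Y w -> z != y -> z != w -> f z y = f z w ->
    mdist y w <= mdist z y / 2.
  (* If w is the nearer point, exchanging y and w gives the even smaller bound d(z,w)/2. *)
  move=> Yz Yy Yw zy zw fzyw; have [le_zyw|lt_zwy] := leP (mdist z y) (mdist z w).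
    by apply: SRA_same_direction_close a01 sraY _ _ _ _ _ => //; apply: fP => //; exact: subY.
  have : mdist w y <= mdist z w / 2.
    apply: SRA_same_direction_close a01 sraY _ _ _ _ _ => //.
    by apply: fP => //; [exact: subY..|exact: ltW].
  by rewrite metric_sym; lra.
have /card_set_bijP[h [_ _ surj_h]] := cardY.
have /choice[g gP] (i : 'I_(two_vertex_bound M M.+1)) : exists y, Y y /\ h y = i.
  by have [y Yy <-] := surj_h i (ltn_ord i); exists y.
have gY i : Y (g i) by have [] := gP i.
have g_neq i j : i != j -> g i != g j.
  apply: contraNneq => gij; apply/eqP/val_inj => /=.
  by have [_ <-] := gP i; have [_ <-] := gP j; rewrite gij.
have [|z [y [q [zy zq yq fz fq]]]] :=
  two_vertex_monochromatic M _ (fun i j => f (g i) (g j)).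
  by rewrite card_ord.
have qy : q != y by rewrite eq_sym.
have qz : q != z by rewrite eq_sym.
have := close _ _ _ (gY z) (gY y) (gY q) (g_neq _ _ zy) (g_neq _ _ zq) fz.
have := close _ _ _ (gY q) (gY y) (gY z) (g_neq _ _ qy) (g_neq _ _ qz) fq.
have := g_neq _ _ zy; rewrite -mdist_gt0.
by rewrite (metric_sym (g q)) (metric_sym (g y) (g z)); lra.
Qed.
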